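(* Let $\mu\in\mathbb{R}$, $\sigma>0$, $\sigma_x>0$, $\delta\in(0,1)$, $p\in[0,1]$, $\eta>0$, and assume that $\eta<1$ and $(1-\delta)\sigma_x<\sqrt{2\pi}\,\sigma^3$. Put $\tau=\sigma^{-2}$ and $\tau_x=\sigma_x^{-2}$, and let $R_0$ (collateral risk), $R_1$ (large sale risk), $\bar\theta_a$ and $x_a^\star$ be as defined in the context. If the quality of fundamentals is sufficiently high (low), then collateral risk and large sale risk decrease (increase) as public knowledge is more precise. Specifically, for $a\in\{0,1\}$: $$\mu>\bar\theta_a(x_a^\star)+\frac{2\tau+\tau_x}{3\tau_x\sqrt{\tau+\tau_x}}\cdot F^{-1}\!\left(\frac{1}{1+\eta}\right)\implies\frac{dR_a}{d\tau}<0,$$ $$\mu<\bar\theta_a(x_a^\star)\implies\frac{dR_a}{d\tau}>0,$$ where $F$ is the standard normal cumulative distribution function.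
   Context: Notation: $F_{m,s}$ is the cumulative distribution function of the normal distribution with mean $m$ and standard deviation $s$; $F=F_{0,1}$. Setting (global game of stablecoin investors): fundamentals $\theta\sim N(\mu,\sigma^2)$; a large seller of mass $\delta$ sells everything with probability $p$ (state $a=1$) and otherwise does not sell (state $a=0$); investors of total mass $1-\delta$ receive private signals $x_i=\theta+\sigma\varepsilon_i$, $\varepsilon_i\sim N(0,\sigma_x^2)$, observe $a$, and each sells (payoff $1$) or holds (payoff $1+\eta$ if the total mass sold is less than $\theta$, and $0$ otherwise). The model specifies the posterior given signal $x$ as $N(\mu_p(x),\sigma_p^2)$ with $\mu_p(x)=\frac{\sigma^2x+\sigma_x^2\mu}{\sigma^2+\sigma_x^2}$ and $\sigma_p^2=\frac{\sigma^2\sigma_x^2}{\sigma^2+\sigma_x^2}$, and the proportion of investors who sell at fundamentals $\theta$, when investors sell exactly at signals below $\bar x$, as $1-F_{\bar x,\sigma_x}(\theta)$. For $a\in\{0,1\}$ and $\bar x\in\mathbb{R}$, $\bar\theta_a(\bar x)$ is the unique real $\theta$ solving $\theta=a\delta+(1-\delta)\bigl(1-F_{\bar x,\sigma_x}(\theta)\bigr)$. The equilibrium switching threshold $x_a^\star$ is the real $\bar x$ (unique under the stated assumption) solving $$F_{\mu_p(\bar x),\sigma_p}(\bar\theta_a(\bar x))-\eta\bigl(1-F_{\mu_p(\bar x),\sigma_p}(\bar\theta_a(\bar x))\bigr)=0 .$$ Risk components: $R_0=(1-p)\,F_{\mu,\sigma}(\bar\theta_0(x_0^\star))$ (collateral risk)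 and $R_1=p\,F_{\mu,\sigma}(\bar\theta_1(x_1^\star))$ (large sale risk). The parameter $\tau$ is the precision of public knowledge (the common prior) and $\mu$ measures the quality of fundamentals. The derivatives are total derivatives in $\tau$, with the other parameters ($\mu,\tau_x,\delta,\eta,p$) fixed and the equilibrium varying with $\tau$.
   Formalization: Adds p<1 for a=0 and p>0 for a=1 (otherwise R_a vanishes identically), and for σ>1 assumes that the threshold x_a* is unique at the given parameters, since the σ³ bound does not ensure this. *)

(* Defs.v *)
From mathcomp Require Import all_boot all_order all_algebra.
From mathcomp Require Import all_classical all_reals all_analysis.
Import Order.TTheory GRing.Theory Num.Theory.
Import numFieldNormedType.Exports.

Set Implicit Arguments.
Unset Strict Implicit.
Unset Printing Implicit Defensive.

Local Open Scope classical_set_scope.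
Local Open Scope ring_scope.

(* F_{m,s}(x); s is the standard deviation, not the variance. *)
Definition normal_cdf (R : realType) (m s x : R) : R :=
  fine (normal_prob m s `]-oo, x]).

(* F^{-1}(q) for F = F_{0,1}; meaningful for 0 < q < 1. *)
Definition std_normal_quantile (R : realType) (q : R) : R :=
  get [set z | normal_cdf 0 1 z = q].

Definition posterior_mean (R : realType) (mu sigma sigma_x x : R) : R :=
  (sigma ^+ 2 * x + sigma_x ^+ 2 * mu) / (sigma ^+ 2 + sigma_x ^+ 2).

Definition posterior_sd (R : realType) (sigma sigma_x : R) : R :=
  Num.sqrt (sigma ^+ 2 * sigma_x ^+ 2 / (sigma ^+ 2 + sigma_x ^+ 2)).

(* Below, the boolean a is the state of the large seller, so a%:R is 0 or 1. *)

Definition theta_bar (R : realType) (delta sigma_x : R) (a : bool) (x : R) : R :=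
  get [set theta |
    theta = a%:R * delta + (1 - delta) * (1 - normal_cdf x sigma_x theta)].

Definition is_switching_threshold (R : realType)
    (mu sigma sigma_x delta eta : R) (a : bool) (x : R) : Prop :=
  let q := normal_cdf (posterior_mean mu sigma sigma_x x)
             (posterior_sd sigma sigma_x) (theta_bar delta sigma_x a x) in
  q - eta * (1 - q) = 0.

(* [get] picks the solution when it is unique, and an arbitrary one otherwise. *)
Definition x_star (R : realType)
    (mu sigma sigma_x delta eta : R) (a : bool) : R :=
  get [set x | is_switching_threshold mu sigma sigma_x delta eta a x].

Definition theta_star (R : realType)
    (mu sigma sigma_x delta eta : R) (a : bool) : R :=
  theta_bar delta sigma_x a (x_star mu sigma sigma_x delta eta a).

Definition collateral_risk (R : realType)
    (mu sigma sigma_x delta eta p : R) : R :=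
  (1 - p) * normal_cdf mu sigma (theta_star mu sigma sigma_x delta eta false).

Definition large_sale_risk (R : realType)
    (mu sigma sigma_x delta eta p : R) : R :=
  p * normal_cdf mu sigma (theta_star mu sigma sigma_x delta eta true).

Definition risk (R : realType)
    (mu sigma sigma_x delta eta p : R) (a : bool) : R :=
  if a then large_sale_risk mu sigma sigma_x delta eta p
  else collateral_risk mu sigma sigma_x delta eta p.

(* The risk as a function of the prior precision t = sigma^{-2}, all other
   parameters being fixed; sigma enters through the prior, the posterior and
   the equilibrium. *)
Definition risk_of_precision (R : realType)
    (mu sigma_x delta eta p : R) (a : bool) (t : R) : R :=
  risk mu (Num.sqrt t)^-1 sigma_x delta eta p a.

Definition state_prob (R : realType) (p : R) (a : bool) : R :=
  if a then p else 1 - p.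

(* Main.v *)
(* Standardize the cutoff: with z = (theta - x) / sigma_x, the fundamentals that
   the mass sold just matches are theta = T z = a delta + (1 - delta) (1 - F z),
   the signal cutoff is x = T z - sigma_x z, and with prior precision t the
   equilibrium condition becomes
     t (T z - mu) + z / sigma_x + kappa sqrt (t + tau_x) = 0,
   where kappa = F^{-1}(1 / (1 + eta)) > 0.  Uniqueness of the root at t = tau
   is enough to differentiate in t: any selection of roots z(t) stays bounded,
   hence converges to z(tau) as t tends to tau, and Caratheodory's form of the
   derivative then gives z'(tau) as soon as the slope in z,
   sigma_x^-1 - tau (1 - delta) F'(z), is nonzero.  At a unique root the slope
   is positive unless z = 0 (at z <> 0 a nonpositive slope produces a second
   root beyond -z), and a root z = 0 with nonpositive slope has
   mu - theta = kappa s / tau, where s = sqrt (tau + tau_x), which neither case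
   of the theorem allows.  Put w = sigma_x tau (1 - delta) F'(z) < 1.  The
   derivative of the risk has the sign of
   (theta - mu) (1 + w) + w kappa / s. *)

Require Import Defs.
From HB Require Import structures.
From mathcomp Require Import all_boot all_order all_algebra.
From mathcomp Require Import all_classical all_reals all_analysis.
From mathcomp Require Import ring lra.
Import Order.TTheory GRing.Theory Num.Theory.
Import numFieldNormedType.Exports.
Local Open Scope classical_set_scope.
Local Open Scope ring_scope.

Set Implicit Arguments.
Unset Strict Implicit.
Unset Printing Implicit Defensive.

(** * Monotonicity and intermediate values on the real line *)

Lemma is_derive_continuous (R : realType) (f df : R -> R) :
  (forall x : R, is_derive x 1 f (df x)) -> continuous f.
Proof.
by move=> fdf x; apply/differentiable_continuous/derivable1_diffP.
Qed.

Lemma derive_gt0_lt (R : realType) (f df : R -> R) (a b : R) :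
  (forall x : R, is_derive x 1 f (df x)) ->
  (forall x, a < x < b -> 0 < df x) -> a < b -> f a < f b.
Proof.
move=> fdf df_gt0 ab.
have [|c cab] := MVT ab (fun x _ => fdf x).
  exact/continuous_subspaceT/is_derive_continuous.
rewrite -subr_gt0 => ->; rewrite mulr_gt0 ?subr_gt0 ?df_gt0//.
Qed.

Lemma continuous_IVT (R : realType) (f : R -> R) (a b v : R) :
  continuous f -> a <= b -> f a <= v <= f b -> exists2 c, a <= c <= b & f c = v.
Proof.
move=> fC ab /andP[av vb].
have [||c] := @IVT R f a b v ab; first exact: continuous_subspaceT.
  by rewrite ge_min av le_max vb orbT.
by rewrite in_itv/=; exists c.
Qed.

Lemma IVT_infty (R : realType) (f : R -> R) (v : R) : continuous f ->
  (\forall x \near -oo, f x <= v) -> (\forall x \near +oo, v <= f x) ->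
  exists c, f c = v.
Proof.
move=> fC fNy fy.
have [a [a0 fa]] : exists a, a <= 0 /\ f a <= v.
  near (-oo : set_system R) => a; exists a; split; near: a => //.
  exact: nbhs_ninfty_le.
have [b [b0 fb]] : exists b, 0 <= b /\ v <= f b.
  near (+oo : set_system R) => b; exists b; split; near: b => //.
  exact: nbhs_pinfty_ge.
have [||c _ fcv] := continuous_IVT (a := a) (b := b) (v := v) fC.
- exact: le_trans b0.
- by rewrite fa fb.
- by exists c.
Unshelve. all: by end_near. Qed.

(** * The normal distribution function and its quantile *)

Lemma is_derive_normal_cdf (R : realType) (m s x : R) : s != 0 ->
  is_derive x 1 (normal_cdf m s) (normal_pdf m s x).
Proof.
move=> s0.
have [||||dF F'x] := @continuous_FTC1 R (normal_pdf m s) -oo%O x (x + 1).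
- by rewrite ltrDl.
- exact: integrableS (integrable_normal_pdf m s).
- by rewrite ltNyr.
- exact: continuous_normal_pdf.
by apply: DeriveDef => //; rewrite -derive1E.
Qed.

(* The library's [cdf] limits are about random variables: the identity is the
   one whose law is the given measure. *)
Definition real_id (R : realType) : measurableTypeR R -> R := idfun.

HB.instance Definition _ (R : realType) :=
  @isMeasurableFun.Build _ _ _ _ (@real_id R) (@measurable_id _ _ setT).

Lemma cvg_normal_cdfy (R : realType) (m s : R) :
  normal_cdf m s x @[x --> +oo] --> (1 : R).
Proof.
exact: (fine_cvg (cvg_cdfy1 (@real_id R : {RV (normal_prob m s) >-> R}))).
Qed.

Lemma cvg_normal_cdfNy (R : realType) (m s : R) :
  normal_cdf m s x @[x --> -oo] --> (0 : R).
Proof.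
exact: (fine_cvg (cvg_cdfNy0 (@real_id R : {RV (normal_prob m s) >-> R}))).
Qed.

(** Used for identities between distribution functions: equal derivatives leave only one limit at
    infinity to compare. *)
Lemma is_derive0_cvg (R : realType) (f : R -> R) (l : R) (F : set_system R) :
  ProperFilter F -> (forall x : R, is_derive x 1 f 0) -> f @ F --> l ->
  forall x, f x = l.
Proof.
move=> PF f0 fl x; have -> : l = lim (f @ F) by apply/esym/cvg_lim.
rewrite (_ : f = cst (f x)) ?lim_cst//.
by apply/funext => y; exact: is_derive_0_is_cst.
Qed.

Lemma normal_pdf_gt0 (R : realType) (m s x : R) : s != 0 ->
  0 < normal_pdf m s x.
Proof.
by move=> s0; rewrite normal_pdfE// mulr_gt0 ?normal_peak_gt0// expR_gt0.
Qed.

Lemma normal_pdf_scale (R : realType) (m s x : R) : 0 < s ->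
  normal_pdf m s x = normal_pdf 0 1 ((x - m) / s) / s.
Proof.
move=> s0; rewrite !normal_pdfE ?gt_eqF// /normal_peak /normal_fun.
rewrite subr0 expr1n mul1r -mulrnAr sqrtrM ?sqr_ge0// sqrtr_sqr gtr0_norm//.
rewrite invfM [RHS]mulrAC [s^-1 * _]mulrC; congr (_ * expR _).
by field; rewrite gt_eqF.
Qed.

(** Both sides have the same derivative and tend to 0 at [-oo]. *)
Lemma normal_cdf_scale (R : realType) (m s x : R) : 0 < s ->
  normal_cdf m s x = normal_cdf 0 1 ((x - m) / s).
Proof.
move=> s0; apply/eqP; rewrite -subr_eq0; apply/eqP.
pose f x := normal_cdf m s x - normal_cdf 0 1 ((x - m) / s).
rewrite -/(f x); move: x; apply: (@is_derive0_cvg _ _ _ (-oo : set_system R)).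
  move=> x.
  have dF := @is_derive_normal_cdf R m s x (lt0r_neq0 s0).
  have dG := @is_derive_normal_cdf R 0 1 ((x - m) / s) (oner_neq0 R).
  have dh : is_derive x 1 (fun x : R => (x - m) / s) s^-1.
    have -> : (fun x : R => (x - m) / s) = (fun x => s^-1 *: (x - m)).
      by apply/funext => y; rewrite mulrC.
    by apply: is_derive_eq; rewrite subr0 scaler1.
  have dGh := @is_derive1_comp R _ (fun x : R => (x - m) / s) x _ _ dG dh.
  apply: is_derive_eq.
  by rewrite [X in X - _]normal_pdf_scale// subrr.
rewrite -[X in _ --> X](subr0 0); apply: cvgB; first exact: cvg_normal_cdfNy.
apply: (cvg_comp _ _ _ (@cvg_normal_cdfNy R 0 1)).
apply/gt0_cvgMlNy; first by rewrite invr_gt0.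
exact: cvg_addrr_Ny.
Qed.

(** The density is even, so F(-x) + F(x) is constant; its limit at [+oo] is 1. *)
Lemma normal_cdfN (R : realType) (x : R) :
  normal_cdf 0 1 (- x) = 1 - normal_cdf 0 1 x.
Proof.
apply/eqP; rewrite -subr_eq opprK; apply/eqP.
pose f (x : R) := normal_cdf 0 1 (- x) + normal_cdf 0 1 x.
rewrite -/(f x); move: x; apply: (@is_derive0_cvg _ _ _ (+oo : set_system R)).
  move=> x.
  have dF := @is_derive_normal_cdf R 0 1 x (oner_neq0 R).
  have dG := @is_derive_normal_cdf R 0 1 (- x) (oner_neq0 R).
  have dGh := @is_derive1_comp R _ -%R x _ _ dG (is_deriveNid x 1).
  apply: is_derive_eq.
  by rewrite !normal_pdfE// /normal_fun !subr0 sqrrN mulrN1 addNr.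
rewrite -[X in _ --> X]add0r; apply: cvgD; last exact: cvg_normal_cdfy.
exact: (proj1 (cvgNy_compNP _ _) (@cvg_normal_cdfNy R 0 1)).
Qed.

Lemma normal_cdf_lt (R : realType) (m s : R) : s != 0 ->
  {mono normal_cdf m s : x y / x < y}.
Proof.
move=> s0; apply/leW_mono/le_mono => x y xy.
apply: (derive_gt0_lt (df := normal_pdf m s)) => // z.
  exact: is_derive_normal_cdf.
by rewrite normal_pdf_gt0.
Qed.

Lemma normal_cdf_inj (R : realType) (m s : R) : s != 0 ->
  injective (normal_cdf m s).
Proof.
move=> s0 x y Fxy.
by case: (ltgtP x y) => //; rewrite -(normal_cdf_lt m s0) Fxy ltxx.
Qed.

Lemma continuous_normal_cdf (R : realType) (m s : R) : s != 0 ->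
  continuous (normal_cdf m s).
Proof.
by move=> s0; apply: is_derive_continuous => x; exact: is_derive_normal_cdf.
Qed.

Lemma normal_cdf_ge0 (R : realType) (m s x : R) : 0 <= normal_cdf m s x.
Proof. exact: fine_ge0. Qed.

Lemma normal_cdf_le1 (R : realType) (m s x : R) : normal_cdf m s x <= 1.
Proof.
by rewrite -lee_fin fineK ?fin_num_measure// probability_le1.
Qed.

Lemma std_normal_quantileK (R : realType) (q : R) : 0 < q < 1 ->
  normal_cdf 0 1 (std_normal_quantile q) = q.
Proof.
move=> /andP[q0 q1].
have : exists z, normal_cdf 0 1 z = q.
  apply: IVT_infty; first exact/continuous_normal_cdf/oner_neq0.
  - by near=> x; apply: ltW; near: x; exact: cvgr_lt (cvg_normal_cdfNy 0 1) _ q0.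
  - by near=> x; apply: ltW; near: x; exact: cvgr_gt (cvg_normal_cdfy 0 1) _ q1.
exact: getPex.
Unshelve. all: by end_near. Qed.

(** By symmetry F(0) = 1/2, and F is strictly increasing. *)
Lemma std_normal_quantile_gt0 (R : realType) (q : R) : 2^-1 < q < 1 ->
  0 < std_normal_quantile q.
Proof.
move=> /andP[q2 q1]; rewrite -(normal_cdf_lt 0 (oner_neq0 R)).
rewrite std_normal_quantileK; last by rewrite q1 (lt_trans _ q2)// invr_gt0.
by have := normal_cdfN (0 : R); rewrite oppr0; lra.
Qed.

(** * Limits and derivatives of a selection of roots *)

(* Every cluster point of the bounded [Z] is a root of [f z = v]. *)
Lemma cvg_unique_preimage (R : realType) (I : Type) (F : set_system I)
    (f : R -> R) (Z : I -> R) (v z0 M : R) :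
  ProperFilter F -> continuous f -> (\forall t \near F, `|Z t| <= M) ->
  f (Z t) @[t --> F] --> v -> (forall z, f z = v -> z = z0) ->
  Z t @[t --> F] --> z0.
Proof.
move=> PF fC ZM fZv fv.
(* The margin 1 puts [z0] in the interior, so this compact set is a neighbourhood of [z0]. *)
pose V := [set` `[- (M + `|z0| + 1), M + `|z0| + 1]].
have VZ : (Z t @[t --> F]) V.
  rewrite /nbhs/=; near=> t; rewrite /V/= in_itv/= -ler_norml.
  have : `|Z t| <= M by near: t.
  by have := normr_ge0 z0; lra.
have cV : compact V by exact: segment_compact.
have M0 : 0 <= M.
  have [t] := @filter_ex _ _ PF _ ZM.
  by apply: le_trans; exact: normr_ge0.
have clZ y : cluster (Z t @[t --> F]) y -> y = z0.
  move=> Zy; apply/fv/esym/(@Rhausdorff R) => A B Av By.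
  have [|w [/= Aw Bw]] := Zy (f @^-1` A) (f @^-1` B) _ (fC y _ By).
    exact: fZv Av.
  by exists (f w).
apply: (compact_cluster_set1 (@Rhausdorff R) cV _ _ VZ).
- apply: filterS (near_in_itvoo _); first exact: subset_itv_oo_cc.
  rewrite in_itv/=.
  by have := ler_norm z0; have := ler_norm (- z0); rewrite normrN; lra.
- apply/seteqP; split => [y /clZ//|_ ->].
  by have [y [_ Zy]] := cV _ _ VZ; rewrite -(clZ y Zy).
Unshelve. all: by end_near. Qed.

(** Caratheodory's criterion with the factorization required only near [x]. *)
Lemma near_caratheodory (R : realType) (f g : R -> R) (x : R) :
  (\forall z \near x, f z - f x = g z * (z - x)) -> {for x, continuous g} ->
  is_derive x 1 f (g x).
Proof.
move=> fg gC; apply: (@near_eq_is_derive _ _ _ (fun z => f x + g z * (z - x))).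
  by near=> z; rewrite -(near fg z) ?addrNK 1?addrC ?subrK.
apply/is_derive1_caratheodory; exists g; split=> // z.
by rewrite subrr mulr0 addr0 addrAC subrr add0r.
Unshelve. all: by end_near. Qed.

(** Let k and h be the Caratheodory factors of [T] at [Z t0] and of [H] at [t0]. Subtracting the
    equations at t and t0 gives (t0 k(Z t) + b) (Z t - Z t0) = (h t - T(Z t)) (t - t0). The first
    factor is nonzero near t0, so continuity of [Z] at t0 suffices. *)
Lemma implicit_derive (R : realType) (T H Z : R -> R) (b t0 dT dH : R) :
  (\forall t \near t0, t * T (Z t) + Z t * b = H t) ->
  {for t0, continuous Z} ->
  is_derive (Z t0) 1 T dT -> is_derive t0 1 H dH -> t0 * dT + b != 0 ->
  is_derive t0 1 Z ((dH - T (Z t0)) / (t0 * dT + b)).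
Proof.
move=> ZH ZC TD HD D0.
have TC : {for Z t0, continuous T}.
  by apply/differentiable_continuous/derivable1_diffP; case: TD.
have [k [Tk kC kdT]] := (is_derive1_caratheodory _ _ _).1 TD.
have [h [Hh hC hdH]] := (is_derive1_caratheodory _ _ _).1 HD.
pose e t := t0 * k (Z t) + b.
have eC : {for t0, continuous e}.
  apply: continuousD; last exact: cst_continuous.
  apply: continuousM; first exact: cst_continuous.
  exact: continuous_comp.
have e0 : e t0 = t0 * dT + b by rewrite /e kdT.
rewrite -e0 -hdH; apply: (@near_caratheodory _ _ (fun t => (h t - T (Z t)) / e t)).
  have ZH0 := nbhs_singleton ZH.
  near=> t.
  have et0 : e t != 0.
    by near: t; apply: cvgr_neq0 eC _; rewrite e0.
  have ZHt : t * T (Z t) + Z t * b = H t by near: t.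
  apply: (mulfI et0); rewrite mulrA mulrCA divff// mulr1.
  rewrite mulrBl -Hh -ZHt -ZH0.
  rewrite mulrDl -mulrA -Tk; ring.
apply: continuousM.
  by apply: continuousB => //; exact: continuous_comp.
by apply: continuousV => //; rewrite e0.
Unshelve. all: by end_near. Qed.

Lemma is_derive_affine (R : realType) (f : R -> R) (b m x df : R) :
  is_derive x 1 f df -> is_derive x 1 (fun z => b + m * f z) (m * df).
Proof.
move=> /is_derive1_caratheodory [g [fg gC <-]].
apply/is_derive1_caratheodory; exists (fun z => m * g z); split=> // [z|].
  by rewrite -mulrA -fg; ring.
by apply: continuousM => //; exact: cst_continuous.
Qed.

(** * The equilibrium in terms of the standardized cutoff *)

Definition critical_theta (R : realType) (delta : R) (a : bool) (z : R) : R :=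
  a%:R * delta + (1 - delta) * (1 - normal_cdf 0 1 z).

Definition cutoff (R : realType) (delta sigma_x : R) (a : bool) (z : R) : R :=
  critical_theta delta a z - sigma_x * z.

Lemma critical_theta_01 (R : realType) (delta : R) (a : bool) (z : R) :
  0 < delta < 1 -> 0 <= critical_theta delta a z <= 1.
Proof.
move=> /andP[d0 d1]; rewrite /critical_theta.
have := normal_cdf_ge0 0 1 z; have := normal_cdf_le1 0 1 z.
by case: a => /=; nra.
Qed.

Lemma is_derive_critical_theta (R : realType) (delta : R) (a : bool) (z : R) :
  is_derive z 1 (critical_theta delta a) (- ((1 - delta) * normal_pdf 0 1 z)).
Proof.
have dF := @is_derive_normal_cdf R 0 1 z (oner_neq0 R).
have := is_derive_affine (a%:R * delta + (1 - delta)) (- (1 - delta)) dF.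
rewrite mulNr; congr is_derive; apply/funext => y.
by rewrite /critical_theta; ring.
Qed.

Lemma continuous_critical_theta (R : realType) (delta : R) (a : bool) :
  continuous (critical_theta delta a).
Proof.
apply: (@is_derive_continuous _ _ (fun z => - ((1 - delta) * normal_pdf 0 1 z))).
by move=> z; exact: is_derive_critical_theta.
Qed.

Lemma cutoff_inj (R : realType) (delta sigma_x : R) (a : bool) :
  0 < delta < 1 -> 0 < sigma_x -> injective (cutoff delta sigma_x a).
Proof.
move=> /andP[_ d1] sx0.
have dec y z : y < z -> cutoff delta sigma_x a z < cutoff delta sigma_x a y.
  move=> yz; rewrite /cutoff /critical_theta.
  have : normal_cdf 0 1 y < normal_cdf 0 1 z by rewrite normal_cdf_lt ?oner_neq0.
  by nra.
move=> y z yz; case: (ltgtP y z) => // /dec; rewrite yz ltxx//.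
Qed.

(** The bounded [critical_theta] cannot offset the linear term at infinity. *)
Lemma cutoff_surj (R : realType) (delta sigma_x : R) (a : bool) (x : R) :
  0 < delta < 1 -> 0 < sigma_x -> exists z, cutoff delta sigma_x a z = x.
Proof.
move=> d01 sx0; pose f z := sigma_x * z - critical_theta delta a z.
have [||| z fz] := @IVT_infty R f (- x).
- move=> z; apply: continuousB; last exact: continuous_critical_theta.
  exact: mulrl_continuous.
- near=> z.
  have : z <= - x / sigma_x by near: z; apply/nbhs_ninfty_le/num_real.
  rewrite ler_pdivlMr// mulrC /f /=.
  by have /andP[] := critical_theta_01 a z d01; lra.
- near=> z.
  have : (1 - x) / sigma_x <= z by near: z; apply/nbhs_pinfty_ge/num_real.
  rewrite ler_pdivrMr// mulrC /f /=.
  by have /andP[] := critical_theta_01 a z d01; lra.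
- by exists z; rewrite /cutoff -[RHS]opprK -fz opprB.
Unshelve. all: by end_near. Qed.

(** A solution y with w = (y - x) / sigma_x satisfies [cutoff] w = x, so injectivity of [cutoff]
    makes the solution unique and [get] returns it. *)
Lemma theta_bar_cutoff (R : realType) (delta sigma_x : R) (a : bool) (z : R) :
  0 < delta < 1 -> 0 < sigma_x ->
  theta_bar delta sigma_x a (cutoff delta sigma_x a z) = critical_theta delta a z.
Proof.
move=> d01 sx0; rewrite /theta_bar; apply: get_unique => /= [|y].
  rewrite normal_cdf_scale// /cutoff subKr.
  by rewrite mulrAC divff ?mul1r// gt_eqF.
rewrite normal_cdf_scale//.
set x := cutoff _ _ _ z; set w := (y - x) / sigma_x => yE.
suff <- : w = z by [].
apply: (cutoff_inj (a := a) d01 sx0); rewrite -/x.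
rewrite {1}/cutoff /critical_theta -yE mulrC divfK ?gt_eqF//; ring.
Qed.

(** The condition says q = eta / (1 + eta) = F(-kappa). The posterior has precision s^2 = t + tau_x,
    hence (T - m) s = -kappa; multiplying by s makes this explicit in z. *)
Lemma is_switching_threshold_cutoff (R : realType)
    (mu sigma_x delta eta : R) (a : bool) (t z : R) :
  0 < delta < 1 -> 0 < sigma_x -> 0 < eta -> 0 < t ->
  is_switching_threshold mu (Num.sqrt t)^-1 sigma_x delta eta a
    (cutoff delta sigma_x a z) <->
  t * (critical_theta delta a z - mu) + z / sigma_x +
    std_normal_quantile (1 / (1 + eta)) * Num.sqrt (t + sigma_x ^- 2) = 0.
Proof.
move=> d01 sx0 eta0 t0; rewrite /is_switching_threshold theta_bar_cutoff//.
set T := critical_theta delta a z; set kappa := std_normal_quantile _.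
have s0 : 0 < t + sigma_x ^- 2 by rewrite addr_gt0// invr_gt0 exprn_gt0.
set s := Num.sqrt (t + sigma_x ^- 2).
have s_gt0 : 0 < s by rewrite sqrtr_gt0.
have s2 : s ^+ 2 = t + sigma_x ^- 2 by rewrite sqr_sqrtr// ltW.
have sx_neq0 : sigma_x != 0 by rewrite gt_eqF.
have t_neq0 : t != 0 by rewrite gt_eqF.
have D_neq0 : t * sigma_x ^+ 2 + 1 != 0.
  by rewrite gt_eqF// ltr_wpDl// mulr_ge0 ?sqr_ge0// ltW.
have D'_neq0 : 1 + sigma_x ^+ 2 * t != 0 by rewrite mulrC addrC.
have sdE : posterior_sd (Num.sqrt t)^-1 sigma_x = s^-1.
  rewrite /posterior_sd exprVn sqr_sqrtr ?ltW// -sqrtrV ?ltW//; congr Num.sqrt.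
  by field; rewrite ?sx_neq0 ?t_neq0 ?D_neq0 ?D'_neq0.
rewrite normal_cdf_scale; last by rewrite sdE invr_gt0.
rewrite sdE invrK.
set m := posterior_mean _ _ _ _.
(* The posterior mean weights prior mean and signal by their precisions. *)
have mE : m * s ^+ 2 = t * mu + (T - sigma_x * z) / sigma_x ^+ 2.
  rewrite s2 /m /posterior_mean exprVn sqr_sqrtr ?ltW// /cutoff -/T.
  by field; rewrite ?sx_neq0 ?t_neq0 ?D_neq0 ?D'_neq0.
have kappaE : normal_cdf 0 1 kappa = 1 / (1 + eta).
  apply: std_normal_quantileK.
  by rewrite divr_gt0 ?ltr_pdivrMr//=; lra.
have -> : (normal_cdf 0 1 ((T - m) * s) -
    eta * (1 - normal_cdf 0 1 ((T - m) * s)) = 0) <->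
    normal_cdf 0 1 ((T - m) * s) = normal_cdf 0 1 (- kappa).
  have eta1 : 1 + eta != 0 by rewrite gt_eqF//; lra.
  rewrite normal_cdfN kappaE; set q := normal_cdf _ _ _; split=> [qE|->].
    apply: (mulIf eta1); rewrite mulrBl divfK// mul1r.
    by apply/eqP; rewrite -subr_eq0 -qE; apply/eqP; ring.
  by field.
have -> : (normal_cdf 0 1 ((T - m) * s) = normal_cdf 0 1 (- kappa)) <->
    (T - m) * s = - kappa.
  by split=> [|->//]; apply/normal_cdf_inj/oner_neq0.
have -> : t * (T - mu) + z / sigma_x + kappa * s =
    ((T - m) * s + kappa) * s.
  rewrite mulrDl -mulrA -expr2 mulrBl mE s2.
  by field.
split=> [->|/eqP]; first by rewrite addNr mul0r.
by rewrite mulf_eq0 (gt_eqF s_gt0) orbF addr_eq0 => /eqP.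
Qed.

Lemma is_derive_congr (R : realType) (f g : R -> R) (x df dg : R) :
  is_derive x 1 f df -> f =1 g -> df = dg -> is_derive x 1 g dg.
Proof. by move=> fdf /funext <- <-. Qed.

Lemma is_derive_equilibrium (R : realType) (delta : R) (a : bool) (t b z : R) :
  is_derive z 1 (fun z => t * critical_theta delta a z + z * b)
    (b - t * ((1 - delta) * normal_pdf 0 1 z)).
Proof.
apply: (is_derive_congr (is_deriveD
  (is_derive_affine 0 t (is_derive_critical_theta delta a z))
  (is_derive_affine 0 b (@is_derive_id _ _ z 1)))) => [y|].
  by rewrite fctE /= !add0r [y * b]mulrC.
by rewrite mulr1 mulrN addrC.
Qed.

Lemma continuous_equilibrium (R : realType) (delta : R) (a : bool) (t b : R) :
  continuous (fun z => t * critical_theta delta a z + z * b).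
Proof.
apply: (@is_derive_continuous _ _
  (fun z => b - t * ((1 - delta) * normal_pdf 0 1 z))).
by move=> z; exact: is_derive_equilibrium.
Qed.

(** No slope condition is required: [critical_theta] stays in [0, 1], so the linear term dominates
    at both ends. *)
Lemma equilibrium_exists (R : realType) (delta : R) (a : bool) (t b v : R) :
  0 < delta < 1 -> 0 <= t -> 0 < b ->
  exists z, t * critical_theta delta a z + z * b = v.
Proof.
move=> d01 t0 b0.
apply: (@IVT_infty R (fun z => t * critical_theta delta a z + z * b)).
- exact: continuous_equilibrium.
- near=> z.
  have : z <= (v - t) / b by near: z; apply/nbhs_ninfty_le/num_real.
  by rewrite ler_pdivlMr//; have /andP[] := critical_theta_01 a z d01; nra.
- near=> z.
  have : v / b <= z by near: z; apply/nbhs_pinfty_ge/num_real.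
  by rewrite ler_pdivrMr//; have /andP[] := critical_theta_01 a z d01; nra.
Unshelve. all: by end_near. Qed.

(** * The selected equilibrium as a function of the prior precision *)

Section equilibrium.
Variables (R : realType) (mu sigma_x delta eta : R) (a : bool).
Hypotheses (sigma_x_gt0 : 0 < sigma_x) (delta_01 : 0 < delta < 1).
Hypotheses (eta_gt0 : 0 < eta).

Let T := critical_theta delta a.
Let kappa := std_normal_quantile (1 / (1 + eta)).
Let x t := x_star mu (Num.sqrt t)^-1 sigma_x delta eta a.
Let theta t := theta_star mu (Num.sqrt t)^-1 sigma_x delta eta a.

(* Computed from the solutions that [get] selects at precision [t], whether or
   not they are unique. *)
Definition std_cutoff (t : R) : R := (theta t - x t) / sigma_x.

(** A root exists, so [get] returns a genuine threshold; by surjectivity it is the [cutoff] of some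
    w, and w is recovered as (theta - x) / sigma_x. *)
Lemma std_cutoffP (t : R) : 0 < t ->
  [/\ x t = cutoff delta sigma_x a (std_cutoff t), theta t = T (std_cutoff t) &
    t * (T (std_cutoff t) - mu) + std_cutoff t / sigma_x +
      kappa * Num.sqrt (t + sigma_x ^- 2) = 0].
Proof.
move=> t0; have [z] : exists z, t * (T z - mu) + z / sigma_x +
    kappa * Num.sqrt (t + sigma_x ^- 2) = 0.
  have [||z Hz] := @equilibrium_exists R delta a t sigma_x^-1
    (t * mu - kappa * Num.sqrt (t + sigma_x ^- 2)) delta_01.
  - exact: ltW.
  - by rewrite invr_gt0.
  - by exists z; rewrite -/T in Hz; lra.
move=> /is_switching_threshold_cutoff => /(_ delta_01 sigma_x_gt0 eta_gt0 t0) zP.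
have xP : is_switching_threshold mu (Num.sqrt t)^-1 sigma_x delta eta a (x t).
  by apply: (@getPex _ [set x | is_switching_threshold mu (Num.sqrt t)^-1
    sigma_x delta eta a x]); exists (cutoff delta sigma_x a z).
have [w xw] := cutoff_surj a (x t) delta_01 sigma_x_gt0.
have thetaE : theta t = T w by rewrite /theta /theta_star -/(x t) -xw theta_bar_cutoff.
have -> : std_cutoff t = w.
  rewrite /std_cutoff thetaE -xw /cutoff subKr mulrAC divff ?mul1r//.
  by rewrite gt_eqF.
split; [by rewrite xw|exact: thetaE|].
rewrite -xw in xP.
exact: (is_switching_threshold_cutoff mu a w delta_01 sigma_x_gt0 eta_gt0 t0).1 xP.
Qed.

Let H t := t * mu - kappa * Num.sqrt (t + sigma_x ^- 2).

Lemma std_cutoff_eq (t : R) : 0 < t ->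
  t * T (std_cutoff t) + std_cutoff t / sigma_x = H t.
Proof. by move=> /std_cutoffP[_ _ ?]; rewrite /H; lra. Qed.

Let is_derive_H (t : R) : 0 < t ->
  is_derive t 1 H (mu - kappa / (2 * Num.sqrt (t + sigma_x ^- 2))).
Proof.
move=> t0.
have s0 : 0 < sigma_x ^- 2 + 1 * t.
  by rewrite mul1r addr_gt0// invr_gt0 exprn_gt0.
have dsq := @is_derive1_comp R _ _ t _ _ (is_derive1_sqrt s0)
  (is_derive_affine (sigma_x ^- 2) 1 (@is_derive_id _ _ t 1)).
apply: (is_derive_congr (is_deriveD (is_derive_affine 0 (- kappa) dsq)
  (is_derive_affine 0 mu (@is_derive_id _ _ t 1)))) => [y|].
  by rewrite fctE /H /= !add0r mul1r [y + _]addrC mulNr addrC mulrC.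
by rewrite !mulr1 mul1r mulNr [LHS]addrC [t + _]addrC.
Qed.

(** Inserting the root at precision u into the equation at t leaves the error (u - t) T, which
    vanishes as u tends to t because T is bounded. Uniqueness at t then forces convergence. *)
Lemma cvg_std_cutoff (t : R) : 0 < t ->
  (forall z, t * T z + z / sigma_x = H t -> z = std_cutoff t) ->
  {for t, continuous std_cutoff}.
Proof.
move=> t0 uniq.
have HC : {for t, continuous H}.
  apply/differentiable_continuous/derivable1_diffP.
  by case: (is_derive_H t0).
have T1 z : `|T z| <= 1.
  by have /andP[T0 T1] := critical_theta_01 a z delta_01; rewrite ger0_norm.
(* The radius comes from z = sigma_x (H u - u T z), with |H u| <= |H t| + 1 and u < t + 1 near t. *)
apply: (@cvg_unique_preimage R R (nbhs t) (fun z => t * T z + z / sigma_x)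
  std_cutoff (H t) _ (sigma_x * (`|H t| + 1 + (t + 1))) _ _ _ _ uniq).
- exact: continuous_equilibrium.
- near=> u.
  have u0 : 0 < u by near: u; exact: lt_nbhsr.
  have ut : u < t + 1 by near: u; apply: lt_nbhsl; rewrite ltrDl.
  have Hu : `|H u| <= `|H t| + 1.
    have : `|H t - H u| < 1 by near: u; move/cvgrPdist_lt: HC; apply.
    have := ler_normB (H t) (H t - H u); rewrite subKr; lra.
  have -> : std_cutoff u = sigma_x * (H u - u * T (std_cutoff u)).
    rewrite -std_cutoff_eq// addrC addKr mulrC divfK// gt_eqF//.
  rewrite normrM (gtr0_norm sigma_x_gt0) ler_pM2l//.
  apply: (le_trans (ler_normB _ _)); apply: lerD => //.
  by rewrite normrM (gtr0_norm u0); have := T1 (std_cutoff u); nra.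
have lim : H u - (u - t) * T (std_cutoff u) @[u --> t] --> H t.
  rewrite -[X in _ --> X]subr0; apply: cvgB => //.
  apply/cvgr0Pnorm_lt => e e0; near=> u.
  rewrite normrM; apply: le_lt_trans (ler_piMr (normr_ge0 _) (T1 _)) _.
  by rewrite distrC; near: u; move/cvgrPdist_lt: (@cvg_id _ (nbhs t)); apply.
apply: cvg_trans lim; apply: near_eq_cvg; near=> u.
rewrite -std_cutoff_eq; first by rewrite -/(T _); ring.
by near: u; exact: lt_nbhsr.
Unshelve. all: by end_near. Qed.

Lemma is_derive_std_cutoff (t : R) (dT := - ((1 - delta) * normal_pdf 0 1 (std_cutoff t))) :
  0 < t -> (forall z, t * T z + z / sigma_x = H t -> z = std_cutoff t) ->
  t * dT + sigma_x^-1 != 0 ->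
  is_derive t 1 std_cutoff
    ((mu - kappa / (2 * Num.sqrt (t + sigma_x ^- 2)) - T (std_cutoff t)) /
      (t * dT + sigma_x^-1)).
Proof.
move=> t0 uniq D0; apply: implicit_derive D0.
- near=> u; apply: std_cutoff_eq; near: u; exact: lt_nbhsr.
- exact: cvg_std_cutoff.
- exact: is_derive_critical_theta.
- exact: is_derive_H.
Unshelve. all: by end_near. Qed.

End equilibrium.

(** * Density bounds and the slope at a unique root *)

Lemma std_normal_pdf_lt (R : realType) (y z : R) : `|y| < `|z| ->
  normal_pdf 0 1 z < normal_pdf 0 1 y.
Proof.
move=> yz; rewrite !normal_pdfE ?oner_neq0// ltr_pM2l ?normal_peak_gt0 ?oner_neq0//.
rewrite /normal_fun !subr0 ltr_expR expr1n ltr_pM2r ?invr_gt0// ltrN2.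
by rewrite -[ltLHS]real_normK ?num_real// -[ltRHS]real_normK ?num_real// ltr_pXn2r ?nnegrE.
Qed.

Lemma normal_peak1 (R : realType) : normal_peak 1 = (Num.sqrt (2 * pi))^-1 :> R.
Proof. by rewrite /normal_peak expr1n mul1r mulr_natl. Qed.

Lemma normal_peak1_le (R : realType) : normal_peak 1 <= 2^-1 :> R.
Proof.
rewrite normal_peak1 lef_pV2 ?posrE// ?sqrtr_gt0 ?mulr_gt0 ?pi_gt0//.
rewrite -[leLHS]ger0_norm// -sqrtr_sqr ler_sqrt ?mulr_ge0 ?pi_ge0//.
by rewrite expr2 ler_pM2l ?pi_ge2.
Qed.

(* If the slope were nonpositive at [z0 <> 0], it would be negative on the whole
   of (-|z0|, |z0|), where the density is larger; the left side would then be on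
   the wrong side of [v] at [- z0], and have another root beyond. *)
Lemma equilibrium_slope_gt0 (R : realType) (delta : R) (a : bool) (t b v z0 : R) :
  0 < delta < 1 -> 0 < t -> 0 < b -> z0 != 0 ->
  t * critical_theta delta a z0 + z0 * b = v ->
  (forall z, t * critical_theta delta a z + z * b = v -> z = z0) ->
  0 < b - t * ((1 - delta) * normal_pdf 0 1 z0).
Proof.
move=> d01 t0 b0 z0_neq0 gz0 uniq; rewrite ltNge; apply/negP => slope_le0.
pose g z := t * critical_theta delta a z + z * b.
have gC : continuous g by exact: continuous_equilibrium.
have T01 z := critical_theta_01 a z d01.
have td0 : 0 < t * (1 - delta) by case/andP: d01 => _ d1; rewrite mulr_gt0// subr_gt0.
have dec : g `|z0| < g (- `|z0|).
  have z0_gt0 : 0 < `|z0| by rewrite normr_gt0.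
  suff : 0 + (-1) * g (- `|z0|) < 0 + (-1) * g `|z0| by lra.
  apply: (@derive_gt0_lt _ (fun z => 0 + (-1) * g z)
    (fun z => (-1) * (b - t * ((1 - delta) * normal_pdf 0 1 z)))) => [z|z|].
  - exact/is_derive_affine/is_derive_equilibrium.
  - rewrite -ltr_norml => /std_normal_pdf_lt.
    by rewrite -(ltr_pM2l td0); lra.
  - lra.
have gE : g z0 = v by [].
have [z0_gt0|z0_lt0|] := ltgtP 0 z0; last by move/eqP; rewrite eq_sym (negPf z0_neq0).
- rewrite (gtr0_norm z0_gt0) gE in dec.
  (* Since T <= 1, the choice y <= (v - t) / b gives g y <= v; the root found lies at or below -z0 <
     0 < z0. *)
  pose y := Num.min (- z0) ((v - t) / b).
  have [||z /andP[_ zz0] /uniq zE] := @continuous_IVT _ g y (- z0) v gC.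
  + by rewrite ge_min lexx.
  + rewrite (ltW dec) andbT.
    have : y <= (v - t) / b by rewrite ge_min lexx orbT.
    by rewrite ler_pdivlMr// /g; have /andP[] := T01 y; nra.
  + by move: zz0; rewrite zE; lra.
- rewrite (ltr0_norm z0_lt0) opprK gE in dec.
  (* Symmetrically, T >= 0 and y >= v / b give v <= g y. *)
  pose y := Num.max (- z0) (v / b).
  have [||z /andP[zz0 _] /uniq zE] := @continuous_IVT _ g (- z0) y v gC.
  + by rewrite le_max lexx.
  + rewrite (ltW dec) /=.
    have : v / b <= y by rewrite le_max lexx orbT.
    by rewrite ler_pdivrMr// /g; have /andP[] := T01 y; nra.
  + by move: zz0; rewrite zE; lra.
Qed.

(** * Inequalities behind the threshold on [mu] *)

(** With r = t c^2 the claim reduces to 3 w <= (2 r + 1) (1 + w). For w < 1/2 the factor 2 r + 1 >=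
    1 is enough; otherwise r >= 1/4 and w < 1 give it. *)
Lemma marginal_risk_lt0 (R : realType) (u kappa s c t w : R) :
  0 < kappa -> 0 < s -> 0 < c -> 0 < t -> 0 < w < 1 ->
  (2^-1 <= w -> 4^-1 <= t * c ^+ 2) ->
  u + (2 * t + c ^- 2) / (3 * c ^- 2 * s) * kappa < 0 ->
  u * (1 + w) + w * (kappa / s) < 0.
Proof.
move=> k0 s0 c0 t0 /andP[w0 w1] wr; set q := kappa / s.
have q0 : 0 < q by rewrite divr_gt0.
have -> : (2 * t + c ^- 2) / (3 * c ^- 2 * s) * kappa =
    (2 * (t * c ^+ 2) + 1) / 3 * q.
  by rewrite /q; field; rewrite !gt_eqF.
have : 0 < t * c ^+ 2 by rewrite mulr_gt0// exprn_gt0.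
move: wr; set r := t * c ^+ 2 => wr r0 uq.
have rw : 3 * w <= (2 * r + 1) * (1 + w).
  by have [/wr|] := leP 2^-1 w; nra.
nra.
Qed.

(** At a root z = 0 the left side equals mu - theta, so this keeps mu out of the high-fundamentals
    case. With r = t c^2 it reads 3 (r + 1) <= (2 r + 1) r. *)
Lemma no_flat_equilibrium (R : realType) (kappa s c t : R) :
  0 < kappa -> 0 < s -> 0 < c -> 0 < t < 1 -> s ^+ 2 = t + c ^- 2 ->
  2 <= c * t ->
  kappa * s / t <= (2 * t + c ^- 2) / (3 * c ^- 2 * s) * kappa.
Proof.
move=> k0 s0 c0 /andP[t0 t1] s2 ct.
have -> : (2 * t + c ^- 2) / (3 * c ^- 2 * s) * kappa =
    kappa * ((2 * (t * c ^+ 2) + 1) / 3 / s).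
  by field; rewrite !gt_eqF.
rewrite -mulrA ler_pM2l// ler_pdivrMr// mulrAC ler_pdivlMr// -expr2 s2.
have c20 : 0 < c ^+ 2 by rewrite exprn_gt0.
rewrite -(ler_pM2r c20) mulrDl mulVf ?gt_eqF//.
(* Here t c^2 = (c t)^2 / t, with c t >= 2 and t < 1. *)
have r4 : 4 <= t * c ^+ 2 by nra.
rewrite [leRHS](_ : _ = (2 * (t * c ^+ 2) + 1) / 3 * (t * c ^+ 2)); last by ring.
nra.
Qed.

(** * The derivative of the risk *)

(** Near t the risk is the state probability times F((theta - mu) sqrt t); the chain rule and the
    implicit derivative of the cutoff give the formula. *)
Lemma is_derive_risk (R : realType) (mu sigma_x delta eta p : R) (a : bool)
    (t : R) (Z := std_cutoff mu sigma_x delta eta a)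
    (theta := critical_theta delta a (Z t))
    (slope := (1 - delta) * normal_pdf 0 1 (Z t))
    (kappa := std_normal_quantile (1 / (1 + eta)))
    (s := Num.sqrt (t + sigma_x ^- 2)) :
  0 < sigma_x -> 0 < delta < 1 -> 0 < eta -> 0 < t ->
  (forall z, t * critical_theta delta a z + z / sigma_x = t * mu - kappa * s ->
    z = Z t) ->
  0 < sigma_x^-1 - t * slope ->
  is_derive t 1 (risk_of_precision mu sigma_x delta eta p a)
    (state_prob p a * normal_pdf 0 1 ((theta - mu) * Num.sqrt t) *
     ((theta - mu) * (sigma_x^-1 + t * slope) + t * slope * (kappa / s)) /
     (2 * Num.sqrt t * (sigma_x^-1 - t * slope))).
Proof.
move=> sx0 d01 eta0 t0 uniq D0.
have s0 : 0 < s by rewrite sqrtr_gt0 addr_gt0// invr_gt0 exprn_gt0.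
have r0 : 0 < Num.sqrt t by rewrite sqrtr_gt0.
have r2 : Num.sqrt t ^+ 2 = t by rewrite sqr_sqrtr// ltW.
have DE : t * - slope + sigma_x^-1 = sigma_x^-1 - t * slope by rewrite mulrN addrC.
have dZ : is_derive t 1 Z ((mu - kappa / (2 * s) - theta) / (t * - slope + sigma_x^-1)).
  by apply: is_derive_std_cutoff => //; rewrite -/slope DE gt_eqF.
have dTZ := is_derive1_comp (is_derive_critical_theta delta a (Z t)) dZ.
have dh := is_deriveM (is_derive_affine (- mu) 1 dTZ) (is_derive1_sqrt t0).
have dF := is_derive1_comp (is_derive_normal_cdf 0 _ (oner_neq0 R)) dh.
apply: (near_eq_is_derive (f := fun u => 0 + state_prob p a *
    (normal_cdf 0 1 \o ((fun u => - mu + 1 * (critical_theta delta a \o Z) u) *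
      Num.sqrt)) u)).
  near=> u.
  have u0 : 0 < u by near: u; exact: lt_nbhsr.
  have [_ thetaE _] := std_cutoffP mu a sx0 d01 eta0 u0.
  have -> : risk_of_precision mu sigma_x delta eta p a u = state_prob p a *
      normal_cdf mu (Num.sqrt u)^-1 (theta_star mu (Num.sqrt u)^-1 sigma_x delta eta a).
    by rewrite /risk_of_precision /risk; case: (a).
  rewrite thetaE normal_cdf_scale ?invr_gt0 ?sqrtr_gt0// invrK add0r.
  by rewrite /comp fctE mul1r [- mu + _]addrC.
apply: (is_derive_congr (is_derive_affine 0 (state_prob p a) dF)) => //.
have -> : ((fun u => - mu + 1 * (critical_theta delta a \o Z) u) * Num.sqrt) t =
  (theta - mu) * Num.sqrt t.
  by rewrite fctE /= mul1r addrC.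
rewrite -[RHS]mulrA -[RHS]mulrA; congr (_ * (_ * _)).
rewrite DE /= mul1r [- mu + _]addrC -/theta -/slope /GRing.scale/=.
(* Writing t as r^2 with r = sqrt t turns the identity into one of rational functions. *)
have algE (r h f b k q : R) : r != 0 -> q != 0 -> b - r ^+ 2 * f != 0 ->
  (h - mu) * (2 * r)^-1 +
    r * (1 * (- f * ((mu - k / (2 * q) - h) / (b - r ^+ 2 * f)))) =
  ((h - mu) * (b + r ^+ 2 * f) + r ^+ 2 * f * (k / q)) /
    (2 * r * (b - r ^+ 2 * f)).
  by move=> r_neq0 q_neq0 D_neq0; field; rewrite D_neq0 r_neq0 q_neq0.
have := algE (Num.sqrt t) theta slope sigma_x^-1 kappa s.
by rewrite r2; apply; rewrite gt_eqF.
Unshelve. all: by end_near. Qed.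

(** * Signs of the derivative *)

Unset Implicit Arguments.

(* Two hypotheses are needed beyond the displayed assumptions.  [state_prob]: a
   state of probability 0 has a risk that vanishes identically.  [x_unique]: for
   sigma > 1 the bound on (1 - delta) * sigma_x does not make the equation of
   x_star uniquely solvable; for sigma <= 1 it does. *)
Theorem proposition3p2 (R : realType) (mu sigma sigma_x delta p eta : R)
    (sigma_gt0 : 0 < sigma) (sigma_x_gt0 : 0 < sigma_x)
    (delta_01 : 0 < delta < 1) (p_01 : 0 <= p <= 1) (eta_gt0 : 0 < eta)
    (eta_lt1 : eta < 1)
    (bound : (1 - delta) * sigma_x < Num.sqrt (2 * pi) * sigma ^+ 3)
    (a : bool)
    (state_prob_gt0 : 0 < state_prob p a)
    (x_unique : 1 < sigma ->
       exists! x, is_switching_threshold mu sigma sigma_x delta eta a x) :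
  let tau := sigma ^- 2 in
  let tau_x := sigma_x ^- 2 in
  let theta := theta_bar delta sigma_x a
                 (x_star mu sigma sigma_x delta eta a) in
  let R_a := risk_of_precision mu sigma_x delta eta p a in
  (theta + (2 * tau + tau_x) / (3 * tau_x * Num.sqrt (tau + tau_x))
             * std_normal_quantile (1 / (1 + eta)) < mu ->
     derivable R_a tau 1 /\ derive1 R_a tau < 0) /\
  (mu < theta -> derivable R_a tau 1 /\ 0 < derive1 R_a tau).
Proof.
move=> tau tau_x theta R_a.
have /andP[delta_gt0 delta_lt1] := delta_01.
have tau_gt0 : 0 < tau by rewrite invr_gt0 exprn_gt0.
have sigmaE : sigma = (Num.sqrt tau)^-1.
  by rewrite /tau sqrtrV ?sqr_ge0// sqrtr_sqr gtr0_norm// invrK.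
pose kappa := std_normal_quantile (1 / (1 + eta)).
have kappa_gt0 : 0 < kappa.
  apply: std_normal_quantile_gt0.
  by rewrite ltr_pdivlMr ?ltr_pdivrMr; lra.
pose s := Num.sqrt (tau + tau_x).
have tau_x_gt0 : 0 < tau_x by rewrite invr_gt0 exprn_gt0.
have s_gt0 : 0 < s by rewrite sqrtr_gt0 addr_gt0.
have s2 : s ^+ 2 = tau + tau_x by rewrite sqr_sqrtr// ltW// addr_gt0.
pose z0 := std_cutoff mu sigma_x delta eta a tau.
have [xE thetaE z0P] := std_cutoffP mu a sigma_x_gt0 delta_01 eta_gt0 tau_gt0.
rewrite -/z0 -sigmaE in xE thetaE z0P.
have {}thetaE : theta = critical_theta delta a z0 by rewrite -thetaE.
rewrite -/kappa -/s -thetaE in z0P.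
(* [w z] compares the slopes in z of the two terms of the equilibrium
   equation: it is strictly increasing in z where [w z < 1]. *)
pose w z := sigma_x * tau * ((1 - delta) * normal_pdf 0 1 z).
have w_gt0 (z : R) : 0 < w z.
  by rewrite !mulr_gt0 ?subr_gt0 ?normal_pdf_gt0 ?oner_neq0.
have peak_le (z : R) : normal_pdf 0 1 z <= normal_peak 1.
  exact/normal_pdf_ub/oner_neq0.
have w_le z : w z <= sigma_x * tau / 2.
  have := peak_le z; have := normal_peak1_le R.
  have := normal_pdf_gt0 0 z (oner_neq0 R).
  rewrite /w ler_pM2l ?mulr_gt0//; nra.
(* The assumed bound enters here: tau (1 - delta) sigma_x / sqrt(2 pi) < tau sigma^3 = sigma. *)
have w_sigma z : w z < sigma.
  have sqrt_gt0 : 0 < Num.sqrt (2 * pi) :> R by rewrite sqrtr_gt0 mulr_gt0 ?pi_gt0.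
  have w_peak : w z <= tau * ((1 - delta) * sigma_x * normal_peak 1).
    rewrite /w [leRHS](_ : _ = sigma_x * tau * ((1 - delta) * normal_peak 1)).
      by rewrite !ler_pM2l ?mulr_gt0// subr_gt0.
    by ring.
  apply: le_lt_trans w_peak _.
  rewrite normal_peak1 mulrC ltr_pdivrMr ?exprn_gt0// ltr_pdivrMr//.
  by rewrite (lt_le_trans bound)// mulrC exprS.
have slopeE (z : R) : sigma_x^-1 - tau * ((1 - delta) * normal_pdf 0 1 z) =
    (1 - w z) / sigma_x.
  by rewrite /w; field; rewrite gt_eqF.
have uniq (z : R) : tau * critical_theta delta a z + z / sigma_x =
    tau * mu - kappa * s -> z = z0.
  (* For sigma <= 1, w < 1 everywhere and the equation is strictly monotone; for sigma > 1, the
     assumed unique threshold and injectivity of [cutoff] identify the roots. *)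
  move=> zP; have [sigma1|sigma1] := leP sigma 1.
    have mono y y' : y < y' -> tau * critical_theta delta a y + y / sigma_x <
        tau * critical_theta delta a y' + y' / sigma_x.
      apply: (@derive_gt0_lt _
        (fun z => tau * critical_theta delta a z + z / sigma_x)
        (fun z => sigma_x^-1 - tau * ((1 - delta) * normal_pdf 0 1 z))) => x.
        exact: is_derive_equilibrium.
      rewrite slopeE divr_gt0// subr_gt0; exact: lt_le_trans (w_sigma x) _.
    by case: (ltgtP z z0) => // /mono; rewrite zP -thetaE; lra.
  apply: (cutoff_inj (a := a) delta_01 sigma_x_gt0).
  have [x [_ xuniq]] := x_unique sigma1.
  have thrP y : tau * critical_theta delta a y + y / sigma_x =
      tau * mu - kappa * s -> cutoff delta sigma_x a y = x.
    move=> yP; apply/esym/xuniq; rewrite [X in is_switching_threshold _ X]sigmaE.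
    apply/is_switching_threshold_cutoff => //.
    by rewrite -/kappa -/tau_x -/s; lra.
  by rewrite !thrP// -thetaE; lra.
have w_lt1 : (theta + (2 * tau + tau_x) / (3 * tau_x * s) * kappa < mu) \/
    mu < theta -> w z0 < 1.
  (* If w >= 1 at the root, then sigma > 1, z0 = 0 and sigma_x tau >= 2, so mu lies strictly above
     theta but not above the upper threshold. *)
  move=> side; rewrite ltNge; apply/negP => w1.
  have tau_lt1 : tau < 1.
    have : 1 < sigma by exact: le_lt_trans (w_sigma z0).
    by move=> sigma1; rewrite invf_lt1 ?exprn_gt0// exprn_egt1.
  have z00 : z0 = 0.
    apply/eqP/negPn/negP => z0_neq0.
    have := @equilibrium_slope_gt0 R delta a tau sigma_x^-1 (tau * mu - kappa * s) z0 delta_01 tau_gt0.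
    rewrite invr_gt0 slopeE => /(_ sigma_x_gt0 z0_neq0 _ uniq).
    by rewrite -thetaE pmulr_lgt0 ?invr_gt0//; lra.
  have ct2 : 2 <= sigma_x * tau by have := w_le z0; lra.
  have := @no_flat_equilibrium R kappa s sigma_x tau kappa_gt0 s_gt0 sigma_x_gt0.
  rewrite tau_gt0 tau_lt1 => /(_ isT s2 ct2); rewrite -/tau_x.
  have muE : kappa * s / tau = mu - theta.
    move: z0P; rewrite z00 mul0r addr0 => z0P.
    by apply: (mulIf (lt0r_neq0 tau_gt0)); rewrite divfK ?gt_eqF//; lra.
  have : 0 < kappa * s / tau by rewrite divr_gt0// mulr_gt0.
  by rewrite muE; set gap := (_ / _ * _) in side *; case: side => side; lra.
pose N := (theta - mu) * (1 + w z0) + w z0 * (kappa / s).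
have dR : w z0 < 1 -> exists2 K, 0 < K & is_derive tau 1 R_a (K * N).
  move=> w1.
  have := @is_derive_risk R mu sigma_x delta eta p a tau sigma_x_gt0 delta_01
    eta_gt0 tau_gt0 uniq.
  rewrite -/z0 -thetaE slopeE -/kappa -/tau_x -/s.
  rewrite divr_gt0 ?subr_gt0// => /(_ isT) dR.
  exists (state_prob p a * normal_pdf 0 1 ((theta - mu) * Num.sqrt tau) /
      (2 * Num.sqrt tau * (1 - w z0))).
    rewrite divr_gt0// mulr_gt0 ?normal_pdf_gt0 ?oner_neq0 ?subr_gt0//.
    by rewrite mulr_gt0// sqrtr_gt0.
  apply: (is_derive_congr dR) => //; rewrite /N.
  have : 1 - w z0 != 0 by rewrite gt_eqF// subr_gt0.
  have : Num.sqrt tau != 0 by rewrite gt_eqF// sqrtr_gt0.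
  rewrite /w; move: (Num.sqrt tau) (_ (_ * _)) => r f r_neq0 w_neq0.
  by field; rewrite w_neq0 r_neq0 !gt_eqF.
split=> side.
  have w1 : w z0 < 1 by apply: w_lt1; left.
  have [K K0 dRK] := dR w1; split; first by case: dRK.
  rewrite derive1E derive_val pmulr_rlt0//.
  apply: (@marginal_risk_lt0 _ _ kappa s sigma_x tau) => //; rewrite ?w_gt0//.
    move=> w2.
    (* As tau sigma^2 = 1, it suffices that sigma_x tau >= 1 and sigma >= 1/2, both consequences of
       w >= 1/2. *)
    have -> : tau * sigma_x ^+ 2 = (sigma_x * tau * sigma) ^+ 2.
      by rewrite /tau; field; rewrite gt_eqF.
    have ct1 : 1 <= sigma_x * tau by have := w_le z0; lra.
    have sigma2 : 2^-1 <= sigma by exact/ltW/(le_lt_trans w2).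
    have : 2^-1 <= sigma_x * tau * sigma by nra.
    by nra.
  by move: side; rewrite -/kappa -/s -/tau_x; set gap := (_ / _ * _); lra.
have w1 : w z0 < 1 by apply: w_lt1; right.
have [K K0 dRK] := dR w1; split; first by case: dRK.
rewrite derive1E derive_val pmulr_rgt0// /N addr_gt0// mulr_gt0 ?subr_gt0//.
  by rewrite addr_gt0.
by rewrite divr_gt0.
Qed.
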